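(* Let $\mathbb P=\mathbb P_\Sigma$ be a projective toric surface whose fan $\Sigma$ has $n$ rays, let $e$ be a point of the big torus of $\mathbb P$, and let $I_{\mathbb P}\subseteq k[x_1,\dots,x_n]$ be the lattice ideal of $\mathbb P$. If the Cox ring of $\mathrm{Bl}_e\mathbb P$ is generated in multiplicity $1$, then for any three (distinct) indices $i,j,k\in\{1,\dots,n\}$ one has $I_{\mathbb P}\not\subseteq\langle x_i,x_j,x_k\rangle^2$.
   Context: The ground field $k$ is algebraically closed of characteristic $0$. Let $\rho_1,\dots,\rho_n\in N\cong\mathbb Z^2$ be the primitive generators of the rays of $\Sigma$, $M=\mathrm{Hom}(N,\mathbb Z)$, and let $L\subseteq\mathbb Z^n$ be the image of $M\to\mathbb Z^n$, $u\mapsto(\langle u,\rho_1\rangle,\dots,\langle u,\rho_n\rangle)$. The lattice ideal of $\mathbb P$ is $I_{\mathbb P}=\langle x^{m^+}-x^{m^-} : m\in L\rangle$, where $m^+=(\max(m_i,0))_i$, $m^-=(-\min(m_i,0))_i$. The Cox ring of $\mathbb P$ is $R=k[x_1,\dots,x_n]$, graded by $\mathrm{Cl}(\mathbb P)$. The Cox ring of $\mathrm{Bl}_e\mathbb P$ is identified with the $\mathrm{Cl}(\mathbb P)\oplus\mathbb Z$-graded subalgebra of $R[t,t^{-1}]$ spanned by the elements $ft^{-i}$, $i\in\mathbb Z$, with $f\in R$ homogeneous such that the divisor of $f$ on $\mathbb P$ has multiplicity at least $i$ at $e$ (so $t$ corresponds to the exceptional divisor). It is generated in multiplicity $m$ if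 it is generated by $t$ together with homogeneous elements of the form $ft^{-i}$ with $f\in R$ and $0\le i\le m$. *)

(* Defs.v *)
From mathcomp Require Import all_boot all_order all_algebra.
From mathcomp Require Import fraction.
From mathcomp Require Import reals.
From mathcomp Require Import mpoly.

Set Implicit Arguments.
Unset Strict Implicit.
Unset Printing Implicit Defensive.

Import Order.TTheory GRing.Theory Num.Theory.
Local Open Scope ring_scope.

Section Fans.

Definition pairing (A : comNzRingType) (u v : 'rV[A]_2) : A :=
  \sum_(j < 2) u 0 j * v 0 j.

Definition primitive_vector (v : 'rV[int]_2) : Prop :=
  gcdz (v 0 0) (v 0 1) = 1.

Variables (R : realType) (n : nat) (rho : 'I_n -> 'rV[int]_2).

(* The cone in N_R = R^2 generated by the rho_i, i in A. *)
Definition cone (A : {set 'I_n}) (v : 'rV[R]_2) : Prop :=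
  exists2 c : 'I_n -> R, (forall i, 0 <= c i) &
    v = \sum_(i in A) c i *: map_mx intr (rho i).

Definition strongly_convex (C : 'rV[R]_2 -> Prop) : Prop :=
  forall v, C v -> C (- v) -> v = 0.

Definition is_face (F C : 'rV[R]_2 -> Prop) : Prop :=
  exists2 u : 'rV[R]_2, (forall v, C v -> 0 <= pairing u v) &
    forall v, F v <-> C v /\ pairing u v = 0.

(* A complete fan in Z^2 with n rays.  Every cone of a fan is generated by
   primitive generators of rays of the fan, so the fan is encoded by the sets
   of indices of the generators of its cones.  A complete toric surface is
   automatically projective. *)
Record complete_fan (Sigma : {set {set 'I_n}}) : Prop := CompleteFan {
  fan_primitive : forall i, primitive_vector (rho i);
  fan_rays_distinct : injective rho;
  fan_rays : forall i, [set i] \in Sigma;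
  fan_strongly_convex : forall A, A \in Sigma -> strongly_convex (cone A);
  fan_faces : forall A F, A \in Sigma -> is_face F (cone A) ->
    exists2 B, B \in Sigma & forall v, F v <-> cone B v;
  fan_inter : forall A B, A \in Sigma -> B \in Sigma ->
    is_face (fun v => cone A v /\ cone B v) (cone A);
  fan_complete : forall v, exists2 A, A \in Sigma & cone A v
}.

End Fans.

Section Ideals.

Variable A : comNzRingType.
Implicit Types (S I J : A -> Prop) (f : A).

Definition ideal_gen S f : Prop :=
  exists2 s : seq (A * A), (forall p, p \in s -> S p.2) &
    f = \sum_(p <- s) p.1 * p.2.

Definition ideal_mul I J : A -> Prop :=
  ideal_gen (fun f => exists g h, [/\ I g, J h & f = g * h]).

Definition ideal_pow I (m : nat) : A -> Prop :=
  iter m (ideal_mul I) (fun _ => True).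

End Ideals.

Definition pos_part (i : int) : nat := `|Num.max i 0|%N.

Section ToricSurface.

Variables (n : nat) (rho : 'I_n -> 'rV[int]_2).

Definition div_char (u : 'rV[int]_2) : 'rV[int]_n :=
  \row_i pairing u (rho i).

Definition lattice_L (m : 'rV[int]_n) : Prop := exists u, m = div_char u.

Definition pos_mnm (m : 'rV[int]_n) : 'X_{1..n} :=
  [multinom pos_part (m ord0 i) | i < n].

Definition row_of_mnm (a : 'X_{1..n}) : 'rV[int]_n := \row_i (a i)%:Z.

Variable k : closedFieldType.

Definition lattice_ideal : {mpoly k[n]} -> Prop :=
  ideal_gen (fun f => exists2 m, lattice_L m &
    f = 'X_[pos_mnm m] - 'X_[pos_mnm (- m)]).

(* Homogeneity (of some degree) for the grading by Cl(P) = Z^n / L. *)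
Definition cl_homogeneous (f : {mpoly k[n]}) : Prop :=
  forall a b, a \in msupp f -> b \in msupp f ->
    lattice_L (row_of_mnm a - row_of_mnm b).

Definition laurent_monomial (v : 'rV[int]_n) : {fraction {mpoly k[n]}} :=
  \prod_(i < n) (tofrac 'X_i) ^ (v 0 i).

(* Pullback of the regular function g on the big torus (with coordinates the
   characters given by the standard basis of M = Z^2) along the Cox quotient
   (k^* )^n -> T. *)
Definition torus_pullback (g : {mpoly k[2]}) : {fraction {mpoly k[n]}} :=
  mmap (fun c => tofrac c%:MP)
    (fun j : 'I_2 => laurent_monomial (div_char (delta_mx 0 j))) g.

Definition maximal_ideal_at (e : 'I_2 -> k) : {mpoly k[2]} -> Prop :=
  ideal_gen (fun g => exists j, g = 'X_j - (e j)%:MP).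

(* The divisor of f has multiplicity at least i at the torus point e.
   Monomials in the x_i have no zeros or poles on the big torus, so g is a
   local equation of div f there; multiplying by a character, it may be taken
   to be a polynomial.  There is no condition on the multiplicity if i <= 0. *)
Definition mult_at_least (e : 'I_2 -> k) (f : {mpoly k[n]}) (i : int) : Prop :=
  exists b g, tofrac f = laurent_monomial b * torus_pullback g /\
    ideal_pow (maximal_ideal_at e) (pos_part i) g.

(* R[t, 1/t] is viewed inside the fraction field of R[t]. *)
Definition laurent_t : {fraction {poly {mpoly k[n]}}} := tofrac 'X.

Definition laurent_elt (f : {mpoly k[n]}) (i : int) :
    {fraction {poly {mpoly k[n]}}} :=
  tofrac f%:P * laurent_t ^ (- i).

(* The k-span of the elements f t^(-i); the set of these elements is already
   stable under scalars. *)
Definition cox_ring_blowup (e : 'I_2 -> k)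
    (x : {fraction {poly {mpoly k[n]}}}) : Prop :=
  exists2 s : seq ({mpoly k[n]} * int),
    (forall p, p \in s -> cl_homogeneous p.1 /\ mult_at_least e p.1 p.2) &
    x = \sum_(p <- s) laurent_elt p.1 p.2.

Inductive subalgebra_gen (S : {fraction {poly {mpoly k[n]}}} -> Prop) :
    {fraction {poly {mpoly k[n]}}} -> Prop :=
| Subalg_gen x of S x : subalgebra_gen S x
| Subalg_const c : subalgebra_gen S (tofrac c%:MP%:P)
| Subalg_add x y of subalgebra_gen S x & subalgebra_gen S y :
    subalgebra_gen S (x + y)
| Subalg_mul x y of subalgebra_gen S x & subalgebra_gen S y :
    subalgebra_gen S (x * y).

Definition generated_in_multiplicity (e : 'I_2 -> k) (m : nat) : Prop :=
  forall x, cox_ring_blowup e x <->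
    subalgebra_gen (fun y => y = laurent_t \/
      exists f (i : nat), [/\ (i <= m)%N, cl_homogeneous f,
        mult_at_least e f i & y = laurent_elt f i]) x.

End ToricSurface.

(* Main.v *)
(* Let p, q, r be the pairings with the three rays.  If I_P lies in
   <x_i, x_j, x_l>^2, then for every u <> 0 in M the positive parts of p(u),
   q(u), r(u) sum to at least 2.  Let gx be a vector with p > 0, q <= 0, r <= 0
   and p minimal, and gy, gz its analogues for the other coordinates.  As the
   rays are primitive, the inequalities q(gx), r(gx) <= 0 are strict, and, as in
   Herzog's description of monomial space curves, gx + gy + gz = 0.  Hence
   3 x^a - x^(a + gx) - x^(a + gy) - x^(a + gz) has multiplicity 2 at e, for any
   a making the exponents nonnegative.  Let K be the set of exponents a for which
   some a + u, u <> 0, is still nonnegative (in the coordinates i, j, l).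
   Homogeneous elements of multiplicity 1 have support in K, so generation in
   multiplicity 1 puts the four exponents in K + K.  But for the smallest
   possible a this fails: either one of the a + gx, a + gy, a + gz lies on a
   coordinate axis and is too small, or 0, gx, gy, gz are the only lattice points
   u with a + u >= 0, and no sum of two of gx, gy, gz is again one of them or 0. *)
Require Import Defs.
From HB Require Import structures.
From mathcomp Require Import all_boot all_order all_algebra.
From mathcomp Require Import fraction reals mpoly zify ring.
From Stdlib Require Import Classical.

Set Implicit Arguments.
Unset Strict Implicit.
Unset Printing Implicit Defensive.

Import Order.TTheory GRing.Theory Num.Theory.
Local Open Scope ring_scope.

(** * Three linear forms on a lattice *)

Section Lattice.

Variable M : zmodType.
Implicit Types (p q r : {additive M -> int}) (u g : M).

(* Unlike the right-hand sides of [raddfN], etc., the ones below carry the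
   instances for [int] that [lia] identifies with those of its other atoms. *)
Fact formN p u : p (- u) = - p u. Proof. exact: raddfN. Qed.
Fact formD p u g : p (u + g) = p u + p g. Proof. exact: raddfD. Qed.
Fact formB p u g : p (u - g) = p u - p g. Proof. exact: raddfB. Qed.

(* For [u] and [- u], this says that both monomials of the binomial of [u] lie in
   the square of the ideal of the three variables. *)
Definition three_forms_sep p q r : Prop := forall u, u != 0 ->
  2 <= Num.max (p u) 0 + Num.max (q u) 0 + Num.max (r u) 0.

(** The first three items come from [u], the last one from [- u], whose three positive parts would
    all vanish. *)
Lemma three_forms_sepP p q r u : three_forms_sep p q r -> u != 0 ->
  [/\ ~ (p u <= 1 /\ q u <= 0 /\ r u <= 0), ~ (p u <= 0 /\ q u <= 1 /\ r u <= 0),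
      ~ (p u <= 0 /\ q u <= 0 /\ r u <= 1) &
      ~ (0 <= p u /\ 0 <= q u /\ 0 <= r u)].
Proof.
move=> H u0; move: (H _ u0); have := H (- u); rewrite oppr_eq0 => /(_ u0).
rewrite !formN => H1 H2; split; lia.
Qed.

Definition spike p q r u : Prop := [/\ 0 < p u, q u <= 0 & r u <= 0].

Definition min_spike p q r g : Prop :=
  spike p q r g /\ forall u, spike p q r u -> p g <= p u.

Lemma ex_min_spike p q r u : spike p q r u -> exists g, min_spike p q r g.
Proof.
have [m] := ubnP `|p u|%N; elim: m u => // m IH u le_u Hu.
have [[v [Hv lt_v]]|no] := classic (exists v, spike p q r v /\ p v < p u).
  by apply: (IH v) => //; case: Hv; case: Hu; lia.
exists u; split => // v Hv; rewrite leNgt; apply/negP => lt_v.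
by apply: no; exists v.
Qed.

Lemma min_spike_lt p q r g : three_forms_sep p q r -> min_spike p q r g ->
  (exists u, q u = 1) -> q g < 0.
Proof.
move=> H [[pg qg rg] ming] [u0 qu0].
rewrite lt_neqAle qg andbT; apply/negP => /eqP qg0.
(* Modulo [g], a vector with [q u = 1] has [0 <= p u < p g]; then [- (u - g)]
   contradicts the minimality of [g]. *)
pose u := u0 - g *~ (p u0 %/ p g)%Z.
have qu : q u = 1 by rewrite /u formB raddfMz /= qg0 mul0rz subr0.
have pu : p u = (p u0 %% p g)%Z.
  rewrite /u formB raddfMz /= /modz; congr (_ - _).
  by rewrite -mulrzr mulrC; congr (_ * _); lia.
have pu_ge : 0 <= p u by rewrite pu modz_ge0 //; lia.
have pu_lt : p u < p g by rewrite pu ltz_pmod.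
clearbody u.
have nz v : q v = 1 -> v != 0.
  by move=> qv; apply/eqP => v0; rewrite v0 raddf0 in qv.
have [_ H2 _ H4] := three_forms_sepP H (nz u qu).
have q1 : q (u - g) = 1 by rewrite formB; lia.
have [_ K2 _ K4] := three_forms_sepP H (nz _ q1).
rewrite !formB in K2 K4.
(* [H4] gives [r u < 0], then [H2] gives [0 < p u], and [K2] gives [0 < r (u - g)]. So [- (u - g)]
   is a spike, at which [p] equals [p g - p u < p g]. *)
have : p g <= p (- (u - g)).
  by apply: ming; rewrite /spike !formN q1 !formB; split; lia.
rewrite formN formB; lia.
Qed.

Lemma min_spike_bound p q r g u : min_spike p q r g -> 0 < p u -> q u <= 0 ->
  r u <= 0 -> p g <= p u.
Proof. by move=> [_ ming] pu qu ru; apply: ming. Qed.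

Definition shifted_ge0 p q r (a b c : int) u : Prop :=
  [/\ 0 <= a + p u, 0 <= b + q u & 0 <= c + r u].

(** Membership in the set [K] of the overview, in terms of the coordinates at the three rays;
    [sum_nonisolated] stands for [K + K]. *)
Definition nonisolated p q r (a b c : int) : Prop :=
  [/\ 0 <= a, 0 <= b & 0 <= c] /\ exists2 u, u != 0 & shifted_ge0 p q r a b c u.

Definition sum_nonisolated p q r (a b c : int) : Prop :=
  exists a' b' c', nonisolated p q r a' b' c' /\
    nonisolated p q r (a - a') (b - b') (c - c').

Lemma three_forms_sep_rot p q r : three_forms_sep p q r -> three_forms_sep q r p.
Proof. by move=> H u /H; lia. Qed.

Lemma three_forms_sep_swap p q r : three_forms_sep p q r -> three_forms_sep p r q.
Proof. by move=> H u /H; lia. Qed.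

Lemma min_spike_swap p q r g : min_spike p q r g -> min_spike p r q g.
Proof. by move=> [[? ? ?] m]; split=> // u [? ? ?]; apply: m. Qed.

(** Separation forces [p u < 0], so [- u] is a spike and [p g <= - p u <= a]. It bounds from below
    the members of [K] on a coordinate axis. *)
Lemma min_spike_axis p q r g a u : three_forms_sep p q r -> min_spike p q r g ->
  u != 0 -> 0 <= a + p u -> 0 <= q u -> 0 <= r u -> p g <= a.
Proof.
move=> H ming u0 pu qu ru; have [_ _ _ nge0] := three_forms_sepP H u0.
have : p g <= p (- u) by apply: (min_spike_bound ming); rewrite formN; lia.
by rewrite formN; lia.
Qed.

Section Config.

Variables (p q r : {additive M -> int}) (gx gy gz : M).
Hypothesis sep : three_forms_sep p q r.
Hypotheses (minx : min_spike p q r gx) (miny : min_spike q r p gy)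
  (minz : min_spike r p q gz).
Hypotheses (ex_p : exists u, p u = 1) (ex_q : exists u, q u = 1)
  (ex_r : exists u, r u = 1).

Lemma spike_facts u : u != 0 ->
  [/\ ~ (0 <= p u /\ 0 <= q u /\ 0 <= r u),
      0 < p u /\ q u <= 0 /\ r u <= 0 -> p gx <= p u,
      q u > 0 /\ r u <= 0 /\ p u <= 0 -> q gy <= q u &
      r u > 0 /\ p u <= 0 /\ q u <= 0 -> r gz <= r u].
Proof.
move=> u0; have [_ _ _ H] := three_forms_sepP sep u0.
by split=> // -[? [? ?]]; [apply: (min_spike_bound minx)
  | apply: (min_spike_bound miny) | apply: (min_spike_bound minz)].
Qed.

Lemma spike_signs : [/\ [/\ 0 < p gx, q gx < 0 & r gx < 0],
  [/\ 0 < q gy, r gy < 0 & p gy < 0] & [/\ 0 < r gz, p gz < 0 & q gz < 0]].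
Proof.
have sep' := three_forms_sep_rot sep; have sep'' := three_forms_sep_rot sep'.
split; split.
- by case: minx => -[].
- exact: min_spike_lt sep minx ex_q.
- exact: min_spike_lt (three_forms_sep_swap sep) (min_spike_swap minx) ex_r.
- by case: miny => -[].
- exact: min_spike_lt sep' miny ex_r.
- exact: min_spike_lt (three_forms_sep_swap sep') (min_spike_swap miny) ex_p.
- by case: minz => -[].
- exact: min_spike_lt sep'' minz ex_p.
- exact: min_spike_lt (three_forms_sep_swap sep'') (min_spike_swap minz) ex_q.
Qed.

(** On [gx + gy] the form [r] is negative, while [p] and [q] are below [p gx] and [q gy]; by
    minimality and separation both must be positive. So [- (gx + gy)] is a spike for [r], whence
    [r gz <= - (r gx + r gy)]. With the cyclic analogues, no form is positive on the total sum,
    which separation allows only at 0. *)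
Lemma spike_sum : gx + gy + gz = 0.
Proof.
have [[px qx rx] [qy ry py] [rz pz qz]] := spike_signs.
have nz (f : {additive M -> int}) u : f u < 0 -> u != 0.
  by apply: contraTneq => ->; rewrite raddf0.
have F u : u != 0 -> _ := fun h => conj (spike_facts h)
  (@spike_facts (- u) (etrans (congr1 negb (oppr_eq0 u)) h)).
have bound_z : r gz <= - (r gx + r gy) /\ - p gy < p gx.
  have /F : gx + gy != 0 by apply: (nz r); rewrite formD; lia.
  by rewrite !(formN, formD) => -[[? ? ? ?] [? ? ? ?]]; lia.
have bound_x : p gx <= - (p gy + p gz).
  have /F : gy + gz != 0 by apply: (nz p); rewrite formD; lia.
  by rewrite !(formN, formD) => -[[? ? ? ?] [? ? ? ?]]; lia.
have bound_y : q gy <= - (q gx + q gz).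
  have /F : gx + gz != 0 by apply: (nz q); rewrite formD; lia.
  by rewrite !(formN, formD) => -[[? ? ? ?] [? ? ? ?]]; lia.
apply/eqP/negPn/negP => /F; rewrite !(formN, formD) => -[_ [? ? ? ?]]; lia.
Qed.

(** Exactly one form is positive on [u], say [p], so [p gx <= p u]. In the first cyclic arrangement
    the third bound is [- r gx], so [p] and [r] are nonnegative on [u - gx]. If this is nonzero, its
    opposite is a spike for [q], with a value below the minimum [q gy]. The other cases are
    symmetric. *)
Lemma spike_in_triangle u : u != 0 ->
    shifted_ge0 p q r (Num.max (- p gy) (- p gz)) (Num.max (- q gx) (- q gz))
      (Num.max (- r gx) (- r gy)) u ->
    (- p gz <= - p gy /\ - q gx <= - q gz /\ - r gy <= - r gx) \/
    (- p gy <= - p gz /\ - q gz <= - q gx /\ - r gx <= - r gy) ->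
  u = gx \/ u = gy \/ u = gz.
Proof.
move=> u0 [Hp Hq Hr] Hc.
have [[px qx rx] [qy ry py] [rz pz qz]] := spike_signs.
have [sp sq sr] : [/\ p gx + p gy + p gz = 0, q gx + q gy + q gz = 0 &
                    r gx + r gy + r gz = 0].
  by rewrite -!formD spike_sum; split; apply: raddf0.
have [n1 k1 k2 k3] := spike_facts u0; have [n2 _ _ _] := three_forms_sepP sep u0.
(* In the first case [p gx <= - p u], although [- p u] is at most the larger of [- p gy] and
   [- p gz], and these are positive with sum [p gx]. *)
have [_ l1 l2 l3] : [/\ True, ~ (p u < 0 /\ 0 <= q u /\ 0 <= r u),
  ~ (q u < 0 /\ 0 <= r u /\ 0 <= p u) & ~ (r u < 0 /\ 0 <= p u /\ 0 <= q u)].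
  split=> // -[? [? ?]].
  - have := min_spike_axis (a := - p u) sep minx u0; lia.
  - have := min_spike_axis (a := - q u) (three_forms_sep_rot sep) miny u0; lia.
  - have := min_spike_axis (a := - r u)
      (three_forms_sep_rot (three_forms_sep_rot sep)) minz u0; lia.
have : (0 < p u /\ q u <= 0 /\ r u <= 0) \/ (p u <= 0 /\ 0 < q u /\ r u <= 0) \/
  (p u <= 0 /\ q u <= 0 /\ 0 < r u).
  by clear k1 k2 k3 Hp Hq Hr Hc; lia.
case=> [[pu [qu ru]]|[[pu [qu ru]]|[pu [qu ru]]]].
- have {}k1 : p gx <= p u by apply: k1.
  clear n1 n2 k2 k3 l1 l2 l3; left;
  have [v0|v0] := eqVneq (u - gx) 0; first exact: subr0_eq.
  have [n1 _ _ _] := spike_facts v0; rewrite -oppr_eq0 in v0.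
  have [_ m1 m2 m3] := spike_facts v0.
  exfalso; rewrite !(formN, formB) in n1 m1 m2 m3.
  by clear m1; case: Hc => Hc; [clear m3 | clear m2]; lia.
- have {}k2 : q gy <= q u by apply: k2.
  clear n1 n2 k1 k3 l1 l2 l3; right; left;
  have [v0|v0] := eqVneq (u - gy) 0; first exact: subr0_eq.
  have [n1 _ _ _] := spike_facts v0; rewrite -oppr_eq0 in v0.
  have [_ m1 m2 m3] := spike_facts v0.
  exfalso; rewrite !(formN, formB) in n1 m1 m2 m3.
  by clear m2; case: Hc => Hc; [clear m1 | clear m3]; lia.
- have {}k3 : r gz <= r u by apply: k3.
  clear n1 n2 k1 k2 l1 l2 l3; right; right;
  have [v0|v0] := eqVneq (u - gz) 0; first exact: subr0_eq.
  have [n1 _ _ _] := spike_facts v0; rewrite -oppr_eq0 in v0.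
  have [_ m1 m2 m3] := spike_facts v0.
  exfalso; rewrite !(formN, formB) in n1 m1 m2 m3.
  by clear m3; case: Hc => Hc; [clear m2 | clear m1]; lia.
Qed.

Lemma spike_triangle :
  exists a b c : int, [/\ 0 <= a, 0 <= b & 0 <= c] /\
    [/\ shifted_ge0 p q r a b c gx, shifted_ge0 p q r a b c gy &
        shifted_ge0 p q r a b c gz] /\
    exists2 s, s \in [:: 0; gx; gy; gz] &
      ~ sum_nonisolated p q r (a + p s) (b + q s) (c + r s).
Proof.
have [[px qx rx] [qy ry py] [rz pz qz]] := spike_signs.
have [sp sq sr] : [/\ p gx + p gy + p gz = 0, q gx + q gy + q gz = 0 &
                    r gx + r gy + r gz = 0].
  by rewrite -!formD spike_sum; split; apply: raddf0.
(* The least exponent that stays nonnegative when any one of the three spikes is added. *)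
exists (Num.max (- p gy) (- p gz)), (Num.max (- q gx) (- q gz)),
  (Num.max (- r gx) (- r gy)).
split; first by split; lia.
split; first by rewrite /shifted_ge0; split; split; lia.
(* Here the last two coordinates vanish at [gx], and the first is less than [2 * p gx]; two members
   of [K] on this axis would add up to at least that. *)
have [[ax1 ax2]|no_x] := classic (- q gz <= - q gx /\ - r gy <= - r gx).
  exists gx; first by rewrite !inE eqxx !orbT.
  move=> [a [b [c [[[a0 b0 c0] [u u0 [u1 u2 u3]]] [[a0' b0' c0'] [v v0 [v1 v2 v3]]]]]]].
  have Hu := min_spike_axis (a := a) sep minx u0.
  have Hv := min_spike_axis (a := (Num.max (- p gy) (- p gz) + p gx) - a) sep minx v0.
  lia.
have [[ax1 ax2]|no_y] := classic (- p gz <= - p gy /\ - r gx <= - r gy).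
  exists gy; first by rewrite !inE eqxx !orbT.
  move=> [a [b [c [[[a0 b0 c0] [u u0 [u1 u2 u3]]] [[a0' b0' c0'] [v v0 [v1 v2 v3]]]]]]].
  have Hu := min_spike_axis (a := b) (three_forms_sep_rot sep) miny u0.
  have Hv := min_spike_axis (a := (Num.max (- q gx) (- q gz) + q gy) - b)
    (three_forms_sep_rot sep) miny v0.
  lia.
have [[ax1 ax2]|no_z] := classic (- p gy <= - p gz /\ - q gx <= - q gz).
  exists gz; first by rewrite !inE eqxx !orbT.
  move=> [a [b [c [[[a0 b0 c0] [u u0 [u1 u2 u3]]] [[a0' b0' c0'] [v v0 [v1 v2 v3]]]]]]].
  have Hu := min_spike_axis (a := c) (three_forms_sep_rot (three_forms_sep_rot sep)) minz u0.
  have Hv := min_spike_axis (a := (Num.max (- r gx) (- r gy) + r gz) - c)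
    (three_forms_sep_rot (three_forms_sep_rot sep)) minz v0.
  lia.
(* No pair of comparisons as above holds, so the larger entries are cyclically
   distributed, as required by [spike_in_triangle]. *)
exists 0; first by rewrite !inE eqxx.
rewrite !raddf0 !addr0.
move=> [a [b [c [[[a0 b0 c0] [u u0 [u1 u2 u3]]] [[a0' b0' c0'] [v v0 [v1 v2 v3]]]]]]].
have T := spike_in_triangle _ _ (ltac:(lia)).
have /T Tu : shifted_ge0 p q r (Num.max (- p gy) (- p gz))
  (Num.max (- q gx) (- q gz)) (Num.max (- r gx) (- r gy)) u by split; lia.
have /T Tv : shifted_ge0 p q r (Num.max (- p gy) (- p gz))
  (Num.max (- q gx) (- q gz)) (Num.max (- r gx) (- r gy)) v by split; lia.
(* The requirements of [u] and [v] add up. Two different spikes share a form on which both are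
   negative, and the sum of what they need exceeds the maximum; a repeated spike needs twice some
   entry of the exponent that it alone already exhausts. *)
have [Eu|[Eu|Eu]] := Tu u0; have [Ev|[Ev|Ev]] := Tv v0; subst u v; lia.
Qed.

Lemma spike_uniq : uniq [:: 0; gx; gy; gz].
Proof.
have [[px qx rx] [qy ry py] [rz pz qz]] := spike_signs.
rewrite /= !inE !negb_or !andbT -!andbA.
by apply/and5P; split; last (apply/andP; split);
  apply/eqP => E; move: (congr1 p E) (congr1 q E) (congr1 r E);
  rewrite ?raddf0; lia.
Qed.

End Config.

(** Separation at [u] and at [- u] forces [p] and [r] to have strictly opposite signs on [u]. *)
Lemma ex_spike p q r u : three_forms_sep p q r -> u != 0 -> q u = 0 ->
  exists v, spike p q r v.
Proof.
move=> H u0 qu; have [_ _ _ H1] := three_forms_sepP H u0.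
have : - u != 0 by rewrite oppr_eq0.
move/(three_forms_sepP H) => [_ _ _]; rewrite !formN => H2.
by have [pu|pu] := leP (p u) 0; [exists (- u); rewrite /spike !formN|exists u];
  split; lia.
Qed.

Lemma exists_spike_triangle p q r : three_forms_sep p q r ->
    (exists u, p u = 1) -> (exists u, q u = 1) -> (exists u, r u = 1) ->
    (exists2 u, u != 0 & p u = 0) -> (exists2 u, u != 0 & q u = 0) ->
    (exists2 u, u != 0 & r u = 0) ->
  exists gx gy gz, [/\ gx + gy + gz = 0, uniq [:: 0; gx; gy; gz] &
    exists a b c : int, [/\ 0 <= a, 0 <= b & 0 <= c] /\
    [/\ shifted_ge0 p q r a b c gx, shifted_ge0 p q r a b c gy &
        shifted_ge0 p q r a b c gz] /\
    exists2 s, s \in [:: 0; gx; gy; gz] &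
      ~ sum_nonisolated p q r (a + p s) (b + q s) (c + r s)].
Proof.
move=> sep p1 q1 r1 [up up0 pu] [uq uq0 qu] [ur ur0 ru].
have sep' := three_forms_sep_rot sep; have sep'' := three_forms_sep_rot sep'.
have [gx minx] : exists g, min_spike p q r g.
  by have [v] := ex_spike sep uq0 qu; apply: ex_min_spike.
have [gy miny] : exists g, min_spike q r p g.
  by have [v] := ex_spike sep' ur0 ru; apply: ex_min_spike.
have [gz minz] : exists g, min_spike r p q g.
  by have [v] := ex_spike sep'' up0 pu; apply: ex_min_spike.
exists gx, gy, gz; split; first exact: (spike_sum sep minx miny minz).
  exact: (spike_uniq sep minx miny minz).
exact: (spike_triangle sep minx miny minz).
Qed.

End Lattice.

(** * Generation in multiplicity 1 and supports *)

Section IdealPowers.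

Variable A : comNzRingType.
Implicit Types (S I J : A -> Prop) (f g : A).

Lemma ideal_gen_mem S f : S f -> ideal_gen S f.
Proof.
move=> Sf; exists [:: (1, f)]; last by rewrite big_seq1 mul1r.
by move=> p; rewrite inE => /eqP ->.
Qed.

Lemma ideal_genD S f g : ideal_gen S f -> ideal_gen S g -> ideal_gen S (f + g).
Proof.
move=> [s Hs ->] [t Ht ->]; exists (s ++ t); last by rewrite big_cat.
by move=> p; rewrite mem_cat => /orP[/Hs|/Ht].
Qed.

Lemma ideal_genMl S f g : ideal_gen S g -> ideal_gen S (f * g).
Proof.
move=> [s Hs ->]; exists [seq (f * p.1, p.2) | p <- s].
  by move=> _ /mapP[p /Hs Sp ->].
by rewrite big_map mulr_sumr; apply: eq_bigr => p _; rewrite mulrA.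
Qed.

Lemma ideal_gen_sub S I f : I 0 -> (forall g h, I g -> I h -> I (g + h)) ->
  (forall g h, I h -> I (g * h)) -> (forall g, S g -> I g) ->
  ideal_gen S f -> I f.
Proof.
move=> I0 ID IM SI [s Hs ->]; rewrite big_seq; apply: big_ind => // p sp.
by apply/IM/SI/Hs.
Qed.

Lemma ideal_pow1 I f : I f -> ideal_pow I 1 f.
Proof. by move=> If; apply: ideal_gen_mem; exists f, 1; rewrite mulr1. Qed.

Lemma ideal_pow2 I f g : I f -> I g -> ideal_pow I 2 (f * g).
Proof.
by move=> If Ig; apply: ideal_gen_mem; exists f, g; split=> //; apply: ideal_pow1.
Qed.

End IdealPowers.

Section SupportConditions.

Variables (k : fieldType) (n : nat).
Implicit Types (P Q T : 'X_{1..n} -> Prop) (f g : {mpoly k[n]}).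

Definition supp_in P f : Prop := forall m, m \in msupp f -> P m.

Lemma supp_in0 P : supp_in P 0.
Proof. by move=> m; rewrite -[0]/(0%:MP) msupp0. Qed.

Lemma supp_inD P f g : supp_in P f -> supp_in P g -> supp_in P (f + g).
Proof. by move=> Hf Hg m /msuppD_le; rewrite mem_cat => /orP[/Hf|/Hg]. Qed.

Lemma supp_inM P Q T f g : (forall a b, P a -> Q b -> T (a + b)%MM) ->
  supp_in P f -> supp_in Q g -> supp_in T (f * g).
Proof.
by move=> PQT Hf Hg m /msuppM_le /allpairsP[[a b] /= [/Hf Pa /Hg Qb ->]]; apply: PQT.
Qed.

Lemma ideal_gen_supp S P f : (forall a b, P b -> P (a + b)%MM) ->
  (forall g, S g -> supp_in P g) -> ideal_gen S f -> supp_in P f.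
Proof.
move=> PD HS; apply: ideal_gen_sub HS; first exact: supp_in0.
  by move=> g h; apply: supp_inD.
by move=> g h; apply: (@supp_inM (fun=> True)) => // a b _; apply: PD.
Qed.

(** Exponents of bounded-below degree in the variables of [I] form an upward closed set, and each
    factor from the ideal raises the bound by one. *)
Lemma ideal_pow_supp_deg (S : {mpoly k[n]} -> Prop) (I : {set 'I_n}) d f :
  (forall g, S g -> exists2 i, i \in I & g = 'X_i) ->
  ideal_pow (ideal_gen S) d f -> supp_in (fun m => d <= \sum_(i in I) m i)%N f.
Proof.
have sumD (a b : 'X_{1..n}) :
    (\sum_(i in I) (a + b)%MM i = \sum_(i in I) a i + \sum_(i in I) b i)%N.
  by rewrite -big_split /=; apply: eq_bigr => i _; rewrite mnmDE.
move=> SX; elim: d f => [//|d IH] f; rewrite /ideal_pow /= -/(ideal_pow _ _).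
apply: ideal_gen_supp => [a b|_ [g [h [Ig Ih ->]]]];
    first by rewrite /= sumD => H; rewrite (leq_trans H) ?leq_addl.
have Hg : supp_in (fun m => 1 <= \sum_(i in I) m i)%N g.
  move: Ig; apply: ideal_gen_supp => [a b|_ /SX[i iI ->] m];
    first by rewrite /= sumD => H; rewrite (leq_trans H) ?leq_addl.
  by rewrite msuppX inE => /eqP ->; rewrite (bigD1 i) //= mnmE eqxx.
by apply: supp_inM Hg (IH _ Ih) => a b; rewrite sumD -[d.+1]add1n; apply: leq_add.
Qed.

End SupportConditions.

(** * The filtration of the Cox ring by sumsets *)

Section CoxFiltration.

Variables (n : nat) (rho : 'I_n -> 'rV[int]_2) (k : closedFieldType).
Variables (K : 'X_{1..n} -> Prop).
Hypothesis K_up : forall a b, K b -> K (a + b)%MM.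

(** The 0-fold sum is the set of all exponents. As [K] is upward closed, this leaves the positive
    sums unchanged and makes the sequence decreasing. *)
Fixpoint sumset_pow (d : nat) (m : 'X_{1..n}) : Prop :=
  if d is d'.+1 then exists a b, [/\ K a, sumset_pow d' b & m = (a + b)%MM]
  else True.

Lemma sumset_powD d d' a b : sumset_pow d a -> sumset_pow d' b ->
  sumset_pow (d + d') (a + b)%MM.
Proof.
elim: d a => [|d IH] a /=.
  move=> _; elim: d' b a => [//|d' IH'] b a /= [b1 [b2 [K1 K2 ->]]].
  exists (a + b1)%MM, b2; split; [exact: K_up | exact: K2 | by rewrite addmA].
move=> [a1 [a2 [K1 K2 ->]]] Hb; exists a1, (a2 + b)%MM.
by split; [|exact: IH|rewrite addmA].
Qed.

Lemma sumset_pow_mono d d' m : (d <= d')%N -> sumset_pow d' m -> sumset_pow d m.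
Proof.
move=> /subnK <-; elim: (d' - d)%N m => //= d0 IH m [a [b [_ Hb ->]]].
by apply: IH; apply: (@sumset_powD 0 _ a b).
Qed.

(* [y] is a Laurent polynomial in [t] whose coefficient of [t^(-c)] has support
   in the [c]-fold sum of [K]; it is represented by [y * t^N]. *)
Definition in_filtration (y : {fraction {poly {mpoly k[n]}}}) : Prop :=
  exists N (p : {poly {mpoly k[n]}}), y * tofrac 'X^N = tofrac p /\
    forall c, supp_in (sumset_pow (N - c)) p`_c.

Lemma subalgebra_in_filtration (S : {fraction {poly {mpoly k[n]}}} -> Prop) y :
  (forall z, S z -> in_filtration z) -> subalgebra_gen S y -> in_filtration y.
Proof.
move=> HS; elim=> {y} [y /HS //|c|x y _ [N [p [Ex Hp]]] _ [N' [p' [Ey Hp']]]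
    |x y _ [N [p [Ex Hp]]] _ [N' [p' [Ey Hp']]]].
- by exists 0, (c%:MP)%:P; rewrite expr0 tofrac1 mulr1; split.
- exists (N + N')%N, (p * 'X^N' + p' * 'X^N); split.
    rewrite exprD !tofracM tofracD !tofracM -Ex -Ey; ring.
  move=> c; rewrite coefD !coefMXn; apply: supp_inD.
    case: ltnP => lt; first exact: supp_in0.
    by move: (Hp (c - N')%N); congr (supp_in (sumset_pow _) _); lia.
  case: ltnP => lt; first exact: supp_in0.
  by move: (Hp' (c - N)%N); congr (supp_in (sumset_pow _) _); lia.
exists (N + N')%N, (p * p'); split; first by rewrite exprD !tofracM -Ex -Ey; ring.
move=> c; rewrite coefM; apply: big_ind => [||i _]; first exact: supp_in0.
  exact: supp_inD.
apply: supp_inM (Hp i) (Hp' (c - i)%N) => a b Ha Hb.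
(* With truncated subtraction the two indices add up to at least [N + N' - c]; this suffices since
   the sumsets decrease. *)
apply: (@sumset_pow_mono _ ((N - i) + (N' - (c - i)))%N); last exact: sumset_powD.
by have := ltn_ord i; lia.
Qed.

Lemma laurent_elt_in_filtration (f : {mpoly k[n]}) (i : nat) :
  in_filtration (laurent_elt f i) <-> supp_in (sumset_pow i) f.
Proof.
have X0 m : tofrac ('X^m : {poly {mpoly k[n]}}) != 0.
  by rewrite tofrac_eq0 monic_neq0 // monicXn.
have E : laurent_elt f i * tofrac 'X^i = tofrac f%:P.
  rewrite /laurent_elt -exprnN /laurent_t -tofracXn -mulrA mulVf ?mulr1 //.
split=> [[N [p [Ep Hp]]]|Hf]; last first.
  exists i, f%:P; split=> // c; rewrite coefC.
  by case: eqP => [->|_]; [rewrite subn0|exact: supp_in0].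
have : f%:P * 'X^N = p * 'X^i.
  by apply/eqP; rewrite -tofrac_eq !tofracM -E -Ep; apply/eqP; ring.
(* The coefficient of degree [N] is [f] on the left and that of [p] at [N - i] on the right, where
   the filtration index is [i]; if [N < i], then [f = 0]. *)
move/(congr1 (fun q : {poly _} => q`_N)); rewrite !coefMXn ltnn subnn coefC eqxx => ->.
case: ltnP => lt; first exact: supp_in0.
by move: (Hp (N - i)%N); congr (supp_in (sumset_pow _) _); lia.
Qed.

(** It suffices to place the generators in the filtration: [t] and the elements of multiplicity 0
    satisfy an empty condition, those of multiplicity 1 the assumption on [K]. *)
Lemma generated_in_multiplicity1_supp e (f : {mpoly k[n]}) (d : nat) :
  generated_in_multiplicity rho e 1 ->
  (forall g, cl_homogeneous rho g -> mult_at_least rho e g 1 -> supp_in K g) ->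
  cl_homogeneous rho f -> mult_at_least rho e f d -> supp_in (sumset_pow d) f.
Proof.
move=> gen HK homf multf; apply/laurent_elt_in_filtration.
have /gen : cox_ring_blowup rho e (laurent_elt f d).
  exists [:: (f, d : int)]; last by rewrite big_seq1.
  by move=> p; rewrite inE => /eqP ->.
apply: subalgebra_in_filtration => z [->|[g [i [i1 homg multg ->]]]].
  by exists 0, 'X; rewrite expr0 tofrac1 mulr1; split.
apply/laurent_elt_in_filtration.
case: i i1 multg => [|[|//]] _ multg; first by [].
move=> m /(HK g homg multg) Km; exists m, 0%MM; split=> //; by rewrite addm0.
Qed.

End CoxFiltration.

(** * Multiplicity at a torus point *)

Section Pairing.

Implicit Types u v w : 'rV[int]_2.

Lemma pairingE u v : pairing u v = u 0 0 * v 0 0 + u 0 1 * v 0 1.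
Proof.
by rewrite /pairing !big_ord_recl big_ord0 addr0; congr (_ * _ + _ * _);
  congr (_ _ _); apply: val_inj.
Qed.

(** The arguments are swapped so that fixing the ray leaves an additive map, to which an instance
    can be attached. *)
Definition ray_form v u := pairing u v.

Fact ray_form_zmod_morphism v : zmod_morphism (ray_form v).
Proof. by move=> u w; rewrite /ray_form !pairingE !mxE; ring. Qed.

HB.instance Definition _ v := GRing.isZmodMorphism.Build _ _ (ray_form v)
  (ray_form_zmod_morphism v).

Variables (n : nat) (rho : 'I_n -> 'rV[int]_2).

Fact div_char_zmod_morphism : zmod_morphism (div_char rho).
Proof.
by move=> u w; apply/rowP => i; rewrite !mxE -!/(ray_form _ _) raddfB.
Qed.

HB.instance Definition _ := GRing.isZmodMorphism.Build _ _ (div_char rho)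
  div_char_zmod_morphism.

End Pairing.

(** * Laurent monomials and the pullback from the torus *)

Section Laurent.

Variables (n : nat) (k : closedFieldType).
Implicit Types (u v : 'rV[int]_n) (m : 'X_{1..n}).

Let laurent := @laurent_monomial n k.

Fact tofrac_X_neq0 (i : 'I_n) : tofrac ('X_i : {mpoly k[n]}) != 0.
Proof.
rewrite tofrac_eq0; apply/eqP => /(congr1 (mcoeff U_(i))).
by rewrite mcoeffXU eqxx mcoeff0 => /eqP; rewrite oner_eq0.
Qed.

Lemma laurent_monomialD u v : laurent (u + v) = laurent u * laurent v.
Proof.
rewrite /laurent /laurent_monomial -big_split; apply: eq_bigr => i _ /=.
by rewrite mxE expfzDr ?tofrac_X_neq0.
Qed.

Lemma laurent_monomial0 : laurent 0 = 1.
Proof. by rewrite /laurent /laurent_monomial big1 // => i _; rewrite mxE expr0z. Qed.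

Lemma laurent_monomialMn u a : laurent (u *+ a) = laurent u ^+ a.
Proof.
by elim: a => [|a IH]; rewrite ?mulr0n ?laurent_monomial0 // mulrS laurent_monomialD IH exprS.
Qed.

Lemma laurent_monomial_mnm m : laurent (row_of_mnm m) = tofrac 'X_[m].
Proof.
rewrite mpolyXE_id rmorph_prod; apply: eq_bigr => i _.
by rewrite mxE rmorphXn.
Qed.

Variable rho : 'I_n -> 'rV[int]_2.

Let pullback := @torus_pullback n rho k.

Let frac_const : {rmorphism k -> {fraction {mpoly k[n]}}} :=
  (@tofrac _ \o @mpolyC n k : {rmorphism _ -> _}).

(** In this form the coefficient map is a bundled ring morphism, so the lemmas on [mmap] apply. *)
Fact pullback_mmapE g : pullback g = mmap frac_const
  (fun j : 'I_2 => laurent_monomial k (div_char rho (delta_mx 0 j))) g.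
Proof. by []. Qed.

Fact pullback_zmod_morphism : zmod_morphism pullback.
Proof. by move=> f g; rewrite !pullback_mmapE raddfB. Qed.

HB.instance Definition _ := GRing.isZmodMorphism.Build _ _
  (@torus_pullback n rho k) pullback_zmod_morphism.

Lemma pullbackZX c (w : 'X_{1..2}) :
  pullback (c *: 'X_[w]) =
  tofrac c%:MP * laurent (div_char rho (row_of_mnm w)).
Proof.
rewrite pullback_mmapE mmapZ mmapX /=; congr (_ * _).
rewrite /mmap1 (eq_bigr (fun j => laurent (div_char rho (delta_mx 0 j) *+ w j))); last first.
  by move=> j _; rewrite laurent_monomialMn.
rewrite -(big_morph laurent laurent_monomialD laurent_monomial0); congr laurent.
under eq_bigr do rewrite -raddfMn.
rewrite -raddf_sum; congr div_char.
rewrite [RHS]row_sum_delta; apply: eq_bigr => j _; rewrite mxE.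
by rewrite -scaler_nat; congr (_ *: _); rewrite -natz.
Qed.

Lemma pullbackE g : pullback g =
  \sum_(w <- msupp g) tofrac (g@_w)%:MP * laurent (div_char rho (row_of_mnm w)).
Proof.
rewrite {1}[g]mpolyE pullback_mmapE raddf_sum; apply: eq_bigr => w _.
by rewrite -pullbackZX.
Qed.

End Laurent.

Section Multiplicity.

Variables (k : closedFieldType) (e : 'I_2 -> k).
Hypothesis e_neq0 : forall j, e j != 0.

Lemma maximal_ideal_pow1_eval g :
  ideal_pow (maximal_ideal_at e) 1 g -> meval e g = 0.
Proof.
have genE S h : (forall h', S h' -> meval e h' = 0) -> ideal_gen S h ->
    meval e h = 0.
  apply: (@ideal_gen_sub _ S (fun h => meval e h = 0)); first exact: meval0.
    by move=> g1 g2; rewrite mevalD => -> ->; rewrite addr0.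
  by move=> g1 g2 g20; rewrite mevalM g20 mulr0.
apply: (genE _ g) => _ [g1 [h [Ig1 _ ->]]]; rewrite mevalM (genE _ _ _ Ig1) ?mul0r //.
by move=> _ [j ->]; rewrite mevalB mevalXU mevalC subrr.
Qed.

(** Scaled to take the value 1 at [e], so that the expansion to first order depends on the exponent
    alone. *)
Definition normalized_monomial (w : 'X_{1..2}) : {mpoly k[2]} :=
  (\prod_j e j ^- w j) *: 'X_[w].

(** Coordinates in which [e] becomes the point with both entries 1. *)
Let y j : {mpoly k[2]} := (e j)^-1%:MP * 'X_j.

Lemma normalized_monomialE w : normalized_monomial w = y 0 ^+ w 0 * y 1 ^+ w 1.
Proof.
rewrite /normalized_monomial mpolyXE_id -mul_mpolyC rmorph_prod -big_split /=.
rewrite !big_ord_recl big_ord0 mulr1 /y !exprMn -!rmorphXn /= !exprVn.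
have -> : lift ord0 ord0 = 1 :> 'I_2 by apply: val_inj.
by [].
Qed.

Lemma maximal_ideal_y j : maximal_ideal_at e (y j - 1).
Proof.
have -> : y j - 1 = (e j)^-1%:MP * ('X_j - (e j)%:MP).
  by rewrite mulrBr -mpolyCM mulVf // mpolyC1.
by apply/ideal_genMl/ideal_gen_mem; exists j.
Qed.

Lemma maximal_ideal_pow2_expr j a :
  ideal_pow (maximal_ideal_at e) 2 (y j ^+ a - 1 - a%:R * (y j - 1)).
Proof.
elim: a => [|a IH].
  rewrite expr0 subrr mul0r subr0 -(mul0r 0); apply: ideal_genMl.
  by rewrite -(subrr (1 * 1)) subrr; exists [::]; rewrite ?big_nil.
have -> : y j ^+ a.+1 - 1 - a.+1%:R * (y j - 1) =
    y j * (y j ^+ a - 1 - a%:R * (y j - 1)) +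
    a%:R * ((y j - 1) * (y j - 1)) by rewrite exprS -natr1; ring.
apply: ideal_genD; apply: ideal_genMl => //.
by apply: ideal_pow2; apply: maximal_ideal_y.
Qed.

Lemma maximal_ideal_pow2_monomial w :
  ideal_pow (maximal_ideal_at e) 2
    (normalized_monomial w - 1 - \sum_j (w j)%:R * (y j - 1)).
Proof.
have -> : \sum_j (w j)%:R * (y j - 1) =
    (w 0)%:R * (y 0 - 1) + (w 1)%:R * (y 1 - 1).
  rewrite !big_ord_recl big_ord0 addr0.
  by have -> : lift ord0 ord0 = 1 :> 'I_2 by apply: val_inj.
rewrite normalized_monomialE.
set a := w 0; set b := w 1.
have -> : y 0 ^+ a * y 1 ^+ b - 1 - (a%:R * (y 0 - 1) + b%:R * (y 1 - 1)) =
    y 1 ^+ b * (y 0 ^+ a - 1 - a%:R * (y 0 - 1)) +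
    ((1 + a%:R * (y 0 - 1)) * (y 1 ^+ b - 1 - b%:R * (y 1 - 1)) +
     a%:R * b%:R * ((y 0 - 1) * (y 1 - 1))) by ring.
apply: ideal_genD; first exact/ideal_genMl/maximal_ideal_pow2_expr.
apply: ideal_genD; first exact/ideal_genMl/maximal_ideal_pow2_expr.
by apply/ideal_genMl/ideal_pow2; apply: maximal_ideal_y.
Qed.

(** The two hypotheses cancel the constant and the linear terms of the expansions at [e], leaving
    the remainders of order two. *)
Lemma maximal_ideal_pow2_sum (T : Type) (s : seq T) (c : T -> int)
    (w : T -> 'X_{1..2}) :
  \sum_(t <- s) c t = 0 ->
  (forall j, \sum_(t <- s) c t * (w t j)%:Z = 0) ->
  ideal_pow (maximal_ideal_at e) 2
    (\sum_(t <- s) (c t)%:~R *: normalized_monomial (w t)).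
Proof.
move=> c0 cw0.
have -> : \sum_(t <- s) (c t)%:~R *: normalized_monomial (w t) =
    \sum_(t <- s) (c t)%:~R * (normalized_monomial (w t) - 1 -
      \sum_j (w t j)%:R * (y j - 1)).
  under [RHS]eq_bigr do rewrite -addrA -opprD mulrBr mulrDr mulr1 mulr_sumr.
  rewrite sumrB big_split /= -[X in _ - (X + _)]rmorph_sum /= c0 rmorph0 add0r.
  rewrite exchange_big /= [X in _ - X]big1 ?subr0 => [|j _].
    by apply: eq_bigr => t _; rewrite -mul_mpolyC rmorph_int.
  under eq_bigr => t _ do rewrite mulrA [X in _ * X * _]pmulrn -intrM.
  by rewrite -mulr_suml -rmorph_sum cw0 mul0r.
elim: s {c0 cw0} => [|t s IH]; first by rewrite big_nil; exists [::]; rewrite ?big_nil.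
rewrite big_cons; apply: ideal_genD IH.
exact/ideal_genMl/maximal_ideal_pow2_monomial.
Qed.

Variables (n : nat) (rho : 'I_n -> 'rV[int]_2).
Hypothesis div_char_eq0 : forall u, div_char rho u = 0 -> u = 0.

Lemma row_of_mnm_inj m : injective (@row_of_mnm m).
Proof.
by move=> a b /rowP ab; apply/mnmP => i; move: (ab i); rewrite !mxE => -[].
Qed.

Lemma row_of_mnm_absz m (v : 'rV[int]_m) : (forall i, 0 <= v 0 i) ->
  row_of_mnm [multinom `|(v 0 i)%R|%N | i < m] = v.
Proof. by move=> v0; apply/rowP => i; rewrite mxE mnmE gez0_abs ?v0 //. Qed.

(** Injectivity of [div_char] sends distinct exponents of [g] to distinct exponents, so no terms
    cancel and [g] has as many terms as [f]. *)
Lemma pullback_monomial (f : {mpoly k[n]}) a b g : msupp f = [:: a] ->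
  tofrac f = laurent_monomial k b * torus_pullback rho g ->
  exists w, msupp g = [:: w].
Proof.
move=> fa.
(* Multiplication by this monomial clears all denominators. *)
pose H : 'X_{1..n} :=
  [multinom (\sum_(w <- msupp g) `|((b + div_char rho (row_of_mnm w)) 0 i)%R|)%N | i < n].
pose v w := b + div_char rho (row_of_mnm w) + row_of_mnm H.
pose mu w : 'X_{1..n} := [multinom `|(v w 0 i)%R|%N | i < n].
have muE w : w \in msupp g -> row_of_mnm (mu w) = v w.
  move=> wg; apply: row_of_mnm_absz => i.
  rewrite /v [X in 0 <= X]mxE [X in _ <= _ + X]mxE mnmE (big_rem w) //=.

  lia.
have mu_inj : {in msupp g &, injective mu}.
  move=> w w' wg w'g /(congr1 (@row_of_mnm n)); rewrite !muE // /v.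
  move/addIr/addrI/eqP; rewrite -subr_eq0 -raddfB => /eqP /div_char_eq0 /eqP.
  by rewrite subr_eq0 => /eqP /row_of_mnm_inj.
rewrite pullbackE => /(congr1 (fun z => z * tofrac 'X_[H])).
rewrite mulrAC -tofracM -laurent_monomial_mnm -laurent_monomialD mulr_sumr.
rewrite (eq_big_seq (fun w => tofrac (g@_w *: 'X_[mu w]))); last first.
  move=> w wg /=; rewrite mulrCA -laurent_monomialD -mul_mpolyC rmorphM /=.
  by rewrite -laurent_monomial_mnm muE // /v addrAC.
rewrite -rmorph_sum => /eqP; rewrite tofrac_eq => /eqP fH.
have mus w : w \in msupp g -> mu w = (H + a)%MM.
  move=> wg; suff : mu w \in msupp (f * 'X_[H]).
    by rewrite (perm_mem (msuppMX _ _)) fa /= inE => /eqP.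
  rewrite fH mcoeff_msupp raddf_sum (bigD1_seq w) ?msupp_uniq //= big_seq_cond.
  rewrite big1 ?addr0 => [|w' /andP[w'g w'w]].
    by rewrite mcoeffZ mcoeffX eqxx mulr1 -mcoeff_msupp.
  rewrite mcoeffZ mcoeffX; case: eqP => [/mu_inj E|]; last by rewrite mulr0.
  by rewrite E ?eqxx in w'w.
case Eg : (msupp g) => [|w s].
  move/(congr1 (mcoeff (H + a)%MM)) : fH; rewrite Eg big_nil mcoeff0 => /eqP.
  rewrite mcoeff_eq0 (perm_mem (msuppMX _ _)) fa /= inE eqxx //.
exists w; case: s Eg => // w' s Eg.
have := msupp_uniq g; rewrite Eg /= !inE negb_or => /andP[/andP[/eqP []]].
apply: mu_inj; rewrite ?Eg ?inE ?eqxx ?orbT //.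
by rewrite !mus // Eg !inE eqxx ?orbT.
Qed.

(** Otherwise the local equation would be a single monomial, which does not vanish on the torus. *)
Lemma mult_at_least1_msupp (f : {mpoly k[n]}) a :
  mult_at_least rho e f 1 -> a \in msupp f -> exists2 b, b \in msupp f & b != a.
Proof.
move=> [b [g [fg mg]]] af.
have [fa|] := boolP (all (pred1 a) (msupp f)); last first.
  by case/allPn=> c cf ca; exists c.
have {fa} fa : msupp f = [:: a].
  move: (msupp_uniq f) af fa; case: (msupp f) => [//|a1 [|a2 s]] /=.
    by rewrite andbT => _ _ /eqP ->.
  rewrite inE negb_or -!andbA => /and4P[n12 _ _ _] _ /and3P[/eqP E1 /eqP E2 _].
  by rewrite E1 E2 eqxx in n12.
have [w gw] := pullback_monomial fa fg.
have /eqP := maximal_ideal_pow1_eval mg.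
rewrite mevalE gw big_seq1 mulf_eq0 -[_ == 0]negbK -mcoeff_msupp gw inE eqxx /=.
by move/prodf_eq0 => [j _]; rewrite expf_eq0 (negbTE (e_neq0 j)) andbF.
Qed.

End Multiplicity.

(** * Polynomials of multiplicity two from affine dependencies *)

Section Circuit.

Variables (k : closedFieldType) (e : 'I_2 -> k).
Hypothesis e_neq0 : forall j, e j != 0.
Variables (n : nat) (rho : 'I_n -> 'rV[int]_2).
Hypothesis div_char_eq0 : forall u, div_char rho u = 0 -> u = 0.

Definition shift_mnm (h : 'rV[int]_n) (t : 'rV[int]_2) : 'X_{1..n} :=
  [multinom `|((h + div_char rho t) 0 i)%R|%N | i < n].

Lemma affine_dependency_mult2 (s : seq 'rV[int]_2) (c : 'rV[int]_2 -> int) h :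
    uniq s -> \sum_(t <- s) c t = 0 -> \sum_(t <- s) t *~ c t = 0 ->
    (forall t i, t \in s -> 0 <= (h + div_char rho t) 0 i) ->
  exists f : {mpoly k[n]}, [/\ cl_homogeneous rho f, mult_at_least rho e f 2 &
    forall t, t \in s -> (c t)%:~R != 0 :> k -> shift_mnm h t \in msupp f].
Proof.
move=> s_uniq c0 ct0 h_ge0.
have shiftE t : t \in s -> row_of_mnm (shift_mnm h t) = h + div_char rho t.
  by move=> ts; apply: row_of_mnm_absz => i; apply: h_ge0.
have shift_inj : {in s &, injective (shift_mnm h)}.
  move=> t t' ts t's /(congr1 (@row_of_mnm n)); rewrite !shiftE //.
  move/addrI/eqP; rewrite -subr_eq0 -raddfB => /eqP /div_char_eq0 /eqP.
  by rewrite subr_eq0 => /eqP.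
(* A translation that makes the exponents on the torus nonnegative; [E t] below is the inverse of
   the value at [e] of the translated monomial. *)
pose T : 'rV[int]_2 := \row_j (\sum_(t <- s) `|(t 0 j)%R|)%N%:Z.
pose w t : 'X_{1..2} := [multinom `|((t + T) 0 j)%R|%N | j < 2].
have wE t : t \in s -> row_of_mnm (w t) = t + T.
  move=> ts; apply: row_of_mnm_absz => i; rewrite !mxE (big_rem t) //=; lia.
pose E t : k := \prod_j e j ^- w t j.
have E0 t : E t != 0.
  by apply/prodf_neq0 => j _; rewrite invr_eq0 expf_neq0.
pose f : {mpoly k[n]} := \sum_(t <- s) ((c t)%:~R * E t) *: 'X_[shift_mnm h t].
exists f; split.
- have f_supp m : m \in msupp f -> exists2 t, t \in s & m = shift_mnm h t.
    move/msupp_sum_le => /flatten_mapP[t].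
    rewrite mem_filter /= => ts /msuppZ_le; rewrite msuppX inE => /eqP ->.
    by exists t.
  move=> _ _ /f_supp[t ts ->] /f_supp[t' t's ->]; exists (t - t').
  by rewrite !shiftE // raddfB /= opprD addrACA subrr add0r.
- exists (h - div_char rho T), (\sum_(t <- s) (c t)%:~R *: normalized_monomial e (w t)).
  split; last first.
    apply: maximal_ideal_pow2_sum => // j.
    under eq_big_seq => t ts.
      have -> : (w t j)%:Z = t 0 j + T 0 j.
        by move/rowP: (wE t ts) => /(_ j); rewrite !mxE.
      rewrite mulrDr; over.
    rewrite big_split /= -mulr_suml c0 mul0r addr0.
    move/rowP: ct0 => /(_ j); rewrite mxE summxE => {2}<-; apply: eq_bigr => t _.
    by rewrite -scaler_int mxE mulrC intz mulrC.
  rewrite /f rmorph_sum [torus_pullback _ _]raddf_sum mulr_sumr; apply: eq_big_seq => t ts /=.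
  rewrite /normalized_monomial scalerA pullbackZX mulrCA -laurent_monomialD.
  rewrite wE // raddfD /= [div_char rho t + _]addrC addrA subrK -shiftE //.
  by rewrite laurent_monomial_mnm -tofracM mul_mpolyC.
move=> t ts ct; rewrite mcoeff_msupp raddf_sum (bigD1_seq t) //= big_seq_cond.
rewrite big1 ?addr0 => [|t' /andP[t's t't]].
  by rewrite mcoeffZ mcoeffX eqxx mulr1 mulf_neq0.
rewrite mcoeffZ mcoeffX; case: eqP => [/shift_inj E1|]; last by rewrite mulr0.
by rewrite E1 ?eqxx in t't.
Qed.

End Circuit.

(** * Three rays *)

Section PrimitiveVectors.

Implicit Types u v : 'rV[int]_2.

Lemma primitive_vector_ray_form v : primitive_vector v -> exists u, ray_form v u = 1.
Proof.
rewrite /primitive_vector => v1; have [a [b]] := Bezoutz (v 0 0) (v 0 1).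
rewrite v1 => ab; exists (\row_j (if j == 0 then a else b)).
by rewrite /ray_form pairingE !mxE.
Qed.

Lemma primitive_vector_perp v : primitive_vector v ->
  exists2 u, u != 0 & ray_form v u = 0.
Proof.
move=> v1; exists (\row_j (if j == 0 then - v 0 1 else v 0 0)).
  apply/eqP => /rowP u0; move: (u0 0) (u0 1) v1; rewrite !mxE /= /primitive_vector.
  by move=> /eqP; rewrite oppr_eq0 => /eqP -> ->.
by rewrite /ray_form pairingE !mxE /=; ring.
Qed.

(** Two vectors orthogonal to [u] have determinant 0; Bezout for [v] then makes [v'] an integer
    multiple of [v], and Bezout for [v'] makes the factor a unit. *)
Lemma primitive_vector_perp_unique u v v' : u != 0 ->
  primitive_vector v -> primitive_vector v' ->
  ray_form v u = 0 -> ray_form v' u = 0 -> v' = v \/ v' = - v.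
Proof.
move=> u0 v1 v'1; rewrite /ray_form !pairingE => uv uv'.
have [x [y xy]] := Bezoutz (v 0 0) (v 0 1); rewrite v1 in xy.
have [x' [y' xy']] := Bezoutz (v' 0 0) (v' 0 1); rewrite v'1 in xy'.
have det0 : v 0 0 * v' 0 1 - v 0 1 * v' 0 0 = 0.
  apply/eqP; apply: contraNT u0 => d; apply/eqP/rowP => j; rewrite mxE.
  apply/eqP; rewrite -(mulIr_eq0 _ (mulIf d)); apply/eqP.
  have [->|->] : j = 0 \/ j = 1.
    by case: j => -[|[|//]] ?; [left|right]; apply: val_inj.
  - have -> : u 0 0 * (v 0 0 * v' 0 1 - v 0 1 * v' 0 0) =
      (u 0 0 * v 0 0 + u 0 1 * v 0 1) * v' 0 1 -
      (u 0 0 * v' 0 0 + u 0 1 * v' 0 1) * v 0 1 by ring.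
    by rewrite uv uv' !mul0r subrr.
  have -> : u 0 1 * (v 0 0 * v' 0 1 - v 0 1 * v' 0 0) =
      (u 0 0 * v' 0 0 + u 0 1 * v' 0 1) * v 0 0 -
      (u 0 0 * v 0 0 + u 0 1 * v 0 1) * v' 0 0 by ring.
  by rewrite uv uv' !mul0r subrr.
pose c := x * v' 0 0 + y * v' 0 1.
have c0 : v' 0 0 = c * v 0 0.
  have -> : c * v 0 0 = (x * v 0 0 + y * v 0 1) * v' 0 0 +
    y * (v 0 0 * v' 0 1 - v 0 1 * v' 0 0) by rewrite /c; ring.
  by rewrite xy det0 mul1r mulr0 addr0.
have c1 : v' 0 1 = c * v 0 1.
  have -> : c * v 0 1 = (x * v 0 0 + y * v 0 1) * v' 0 1 -
    x * (v 0 0 * v' 0 1 - v 0 1 * v' 0 0) by rewrite /c; ring.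
  by rewrite xy det0 mul1r mulr0 subr0.
have {xy'} : c * (x' * v 0 0 + y' * v 0 1) = 1.
  by rewrite -xy' c0 c1; ring.
move: (x' * v 0 0 + y' * v 0 1) => d cd.
have [cE|cE] : c = 1 \/ c = -1.
  by move/eqP: (congr1 absz cd); rewrite abszM muln_eq1 => /andP[/eqP ? _]; lia.
  left; apply/rowP => -[[|[|//]] lt].
    by rewrite (_ : Ordinal lt = 0) ?c0 ?cE ?mul1r //; apply: val_inj.
  by rewrite (_ : Ordinal lt = 1) ?c1 ?cE ?mul1r //; apply: val_inj.
right; apply/rowP => -[[|[|//]] lt]; rewrite mxE.
  by rewrite (_ : Ordinal lt = 0) ?c0 ?cE ?mulN1r //; apply: val_inj.
by rewrite (_ : Ordinal lt = 1) ?c1 ?cE ?mulN1r //; apply: val_inj.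
Qed.

End PrimitiveVectors.

Section ThreeRays.

Variables (k : closedFieldType) (n : nat) (rho : 'I_n -> 'rV[int]_2).
Variables (i j l : 'I_n).

Let p : {additive 'rV[int]_2 -> int} := ray_form (rho i).
Let q : {additive 'rV[int]_2 -> int} := ray_form (rho j).
Let r : {additive 'rV[int]_2 -> int} := ray_form (rho l).

Definition nonisolated_mnm (m : 'X_{1..n}) : Prop :=
  nonisolated p q r (m i) (m j) (m l).

Lemma nonisolated_mnm_up a b : nonisolated_mnm b -> nonisolated_mnm (a + b)%MM.
Proof.
move=> [_ [u u0 [pu qu ru]]]; split; first by split.
by exists u => //; rewrite /shifted_ge0 !mnmDE; split; lia.
Qed.

Lemma sumset_pow2_nonisolated m : sumset_pow nonisolated_mnm 2 m ->
  sum_nonisolated p q r (m i) (m j) (m l).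
Proof.
move=> [a [b [Ka [c [d [Kc _ ->]]] ->]]].
exists (a i), (a j), (a l); split=> //.
move: (@nonisolated_mnm_up d c Kc); rewrite /nonisolated_mnm !mnmDE.
congr (nonisolated _ _ _ _ _ _); lia.
Qed.

Hypotheses (rho_prim : forall i, primitive_vector (rho i)) (rho_inj : injective rho).
Hypotheses (ij : i != j) (il : i != l) (jl : j != l).

(** A nonzero [u] is orthogonal to at most two primitive vectors, which are opposite, hence not to
    three distinct rays. *)
Lemma ray_forms_jointly_injective u : p u = 0 -> q u = 0 -> r u = 0 -> u = 0.
Proof.
move=> pu qu ru; apply/eqP/negPn/negP => u0.
have [/rho_inj/eqP|Ej] := primitive_vector_perp_unique u0 (rho_prim i) (rho_prim j) pu qu.
  by rewrite eq_sym (negbTE ij).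
have [/rho_inj/eqP|El] := primitive_vector_perp_unique u0 (rho_prim i) (rho_prim l) pu ru.
  by rewrite eq_sym (negbTE il).
by move/eqP: jl; apply; apply: rho_inj; rewrite Ej El.
Qed.

Lemma div_char_ray_forms u : [/\ div_char rho u 0 i = p u,
  div_char rho u 0 j = q u & div_char rho u 0 l = r u].
Proof. by rewrite !mxE. Qed.

Lemma div_char_eq0 u : div_char rho u = 0 -> u = 0.
Proof.
move=> /rowP u0; have [pu qu ru] := div_char_ray_forms u.
by apply: ray_forms_jointly_injective; rewrite -?pu -?qu -?ru u0 mxE.
Qed.

Hypothesis I_sub : forall f : {mpoly k[n]}, lattice_ideal rho f ->
  ideal_pow (ideal_gen (fun g => g = 'X_i \/ g = 'X_j \/ g = 'X_l)) 2 f.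

Lemma sum3 (F : 'I_n -> nat) : (\sum_(x in [set i; j; l]) F x = F i + F j + F l)%N.
Proof.
by rewrite setUC big_setU1 ?big_setU1 ?big_set1 ?inE /= ?negb_or 1?eq_sym ?il
  1?eq_sym ?ij ?jl //; lia.
Qed.

(** The two monomials of the binomial of [u] differ, so the first one lies in the support; its
    degree in the three variables is the sum of the positive parts. *)
Lemma lattice_ideal_sub_sep : three_forms_sep p q r.
Proof.
move=> u u0.
have [pu qu ru] : [/\ p u = pairing u (rho i), q u = pairing u (rho j) &
  r u = pairing u (rho l)] by [].
have pE : forall v x, pos_mnm (div_char rho v) x = pos_part (pairing v (rho x)).
  by move=> v x; rewrite mnmE mxE.
have ne : pos_mnm (div_char rho u) != pos_mnm (- div_char rho u).
  apply: contraNneq u0 => E; apply/eqP/ray_forms_jointly_injective.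
  - by move/mnmP: E => /(_ i); rewrite !mnmE !mxE /pos_part pu; lia.
  - by move/mnmP: E => /(_ j); rewrite !mnmE !mxE /pos_part qu; lia.
  - by move/mnmP: E => /(_ l); rewrite !mnmE !mxE /pos_part ru; lia.
pose f : {mpoly k[n]} := 'X_[pos_mnm (div_char rho u)] - 'X_[pos_mnm (- div_char rho u)].
have /I_sub If : lattice_ideal rho f.
  by apply: ideal_gen_mem; exists (div_char rho u) => //; exists u.
have SX (g : {mpoly k[n]}) : g = 'X_i \/ g = 'X_j \/ g = 'X_l ->
    exists2 x, x \in [set i; j; l] & g = 'X_x.
  by move=> [->|[->|->]]; [exists i|exists j|exists l]; rewrite ?inE ?eqxx ?orbT.
have := @ideal_pow_supp_deg _ _ _ _ _ _ SX If (pos_mnm (div_char rho u)).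
rewrite mcoeff_msupp mcoeffB !mcoeffX eqxx [pos_mnm (- _) == _]eq_sym (negbTE ne)
  subr0 oner_eq0 => /(_ isT).
rewrite sum3 !pE /pos_part pu qu ru; lia.
Qed.

(** A second exponent of [f] exists, and by homogeneity it is a translate of [a] by some nonzero
    [u]. *)
Lemma mult_at_least1_nonisolated e (f : {mpoly k[n]}) : (forall x, e x != 0) ->
  cl_homogeneous rho f -> mult_at_least rho e f 1 -> supp_in nonisolated_mnm f.
Proof.
move=> e0 homf multf a af.
have [b bf ba] := mult_at_least1_msupp e0 div_char_eq0 multf af.
have [u uE] := homf _ _ bf af.
split; first by split.
exists u.
  apply: contraNneq ba => u0; apply/eqP/(@row_of_mnm_inj n)/eqP.
  by rewrite -subr_eq0 uE u0 raddf0.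
have [pu qu ru] := div_char_ray_forms u.
by split; [rewrite -pu|rewrite -qu|rewrite -ru]; rewrite -uE !mxE; lia.
Qed.

End ThreeRays.

(** * Three rays of a complete fan *)

Theorem theorem3p5 (R : realType) (k : closedFieldType)
    (char0 : [pchar k] =i pred0)
    (n : nat) (rho : 'I_n -> 'rV[int]_2) (Sigma : {set {set 'I_n}})
    (fanSigma : complete_fan R rho Sigma)
    (e : 'I_2 -> k) (e_torus : forall j, e j != 0)
    (gen1 : generated_in_multiplicity rho e 1)
    (i j l : 'I_n) (ij : i != j) (il : i != l) (jl : j != l) :
  ~ (forall f : {mpoly k[n]}, lattice_ideal rho f ->
       ideal_pow (ideal_gen (fun g => g = 'X_i \/ g = 'X_j \/ g = 'X_l)) 2 f).
Proof.
move=> I_sub; have prim := fan_primitive fanSigma.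
have inj := fan_rays_distinct fanSigma.
have sep := lattice_ideal_sub_sep prim inj ij il jl I_sub.
have unit x := primitive_vector_ray_form (prim x).
have perp x := primitive_vector_perp (prim x).
have [gx [gy [gz [g0 g_uniq [a [b [c [abc0 [[Hx Hy Hz] [t ts not_sum]]]]]]]]]] :=
  exists_spike_triangle sep (unit i) (unit j) (unit l) (perp i) (perp j) (perp l).
pose s := [:: 0; gx; gy; gz].
(* An affine dependency of 0 and the three spikes, as these sum to 0. *)
pose coef (t : 'rV[int]_2) : int := if t == 0 then - 3 else 1.
(* The exponent is prescribed at the three rays only; elsewhere it is taken large enough for all
   four translates to be nonnegative. *)
pose h : 'rV[int]_n := \row_x (if x == i then a else if x == j then b
  else if x == l then c else (\sum_(t <- s) `|(div_char rho t 0 x)%R|)%N%:Z).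
have hE : [/\ h 0 i = a, h 0 j = b & h 0 l = c].
  by rewrite !mxE !eqxx [j == i]eq_sym [l == i]eq_sym [l == j]eq_sym
    (negbTE ij) (negbTE il) (negbTE jl).
have [hi hj hl] := hE.
have h_ge0 u x : u \in s -> 0 <= (h + div_char rho u) 0 x.
  move=> us.
  have [D1 D2 D3] : shifted_ge0 (ray_form (rho i)) (ray_form (rho j))
      (ray_form (rho l)) a b c u.
    by move: us; rewrite !inE => /or4P[] /eqP -> //; rewrite /shifted_ge0 !raddf0 !addr0.
  rewrite mxE; have [->|xi] := eqVneq x i; first by rewrite hi mxE.
  have [->|xj] := eqVneq x j; first by rewrite hj mxE.
  have [->|xl] := eqVneq x l; first by rewrite hl mxE.
  rewrite [h 0 x]mxE (negbTE xi) (negbTE xj) (negbTE xl) (big_rem u) //=.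
  move: (div_char rho u 0 x) (\sum_(y <- _) _)%N => d m; clear; lia.
move: (g_uniq); rewrite /= !inE !negb_or !andbT -!andbA => /and5P[].
rewrite ![0 == _]eq_sym => gx0 gy0 gz0 _ _.
have [||f [homf multf f_supp]] := affine_dependency_mult2 e_torus
    (div_char_eq0 prim inj ij il jl) (s := s) (c := coef) g_uniq _ _ h_ge0.
- by rewrite !big_cons big_nil /coef eqxx (negbTE gx0) (negbTE gy0) (negbTE gz0).
- rewrite !big_cons big_nil /coef eqxx (negbTE gx0) (negbTE gy0) (negbTE gz0).
  by rewrite mul0rz add0r addr0 !mulr1z addrA.
(* For [t = 0] the coefficient is [- 3], nonzero in characteristic 0, so this exponent does occur in
   [f]. *)
have coef0 : (coef t)%:~R != 0 :> k.
  rewrite /coef; case: ifP => _; last by rewrite oner_eq0.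
  rewrite rmorphN oppr_eq0 /= -[3%:~R]/(3%:R).
  by move/pcharf0P: char0 => ->.
apply: not_sum.
have K_up := @nonisolated_mnm_up n rho i j l.
have mult1 g := mult_at_least1_nonisolated prim inj ij il jl (f := g) e_torus.
have := @generated_in_multiplicity1_supp n rho k (nonisolated_mnm rho i j l)
  K_up e f 2 gen1 mult1 homf multf _ (f_supp t ts coef0).
move/sumset_pow2_nonisolated; congr (sum_nonisolated _ _ _ _ _ _).
- by rewrite mnmE gez0_abs ?h_ge0 // mxE hi mxE.
- by rewrite mnmE gez0_abs ?h_ge0 // mxE hj mxE.
- by rewrite mnmE gez0_abs ?h_ge0 // mxE hl mxE.
Qed.
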